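(* Let $\Omega$ be a nonempty open subset of $\mathbb{C}$. Let $\mathcal{S}_p$, $\mathcal{S}_{uc}$ and $\mathcal{S}_u$ be the sets of sequences $(f_n)\in H(\Omega)^{\mathbb{N}}$ that converge to $0$, respectively, pointwise on $\Omega$, uniformly on every compact subset of $\Omega$, and uniformly on $\Omega$. Then the sets $\mathcal{S}_p\setminus\mathcal{S}_{uc}$ and $\mathcal{S}_{uc}\setminus\mathcal{S}_u$ are infinitely pointwise $\mathfrak{c}$-dense-lineable in $H(\Omega)^{\mathbb{N}}$.
   Context: $H(\Omega)$ is the complex vector space of all holomorphic functions on $\Omega$ (which is not assumed connected), endowed with the topology of uniform convergence on compact subsets of $\Omega$. $H(\Omega)^{\mathbb{N}}$ is the complex vector space (termwise operations) of all sequences of holomorphic functions on $\Omega$, endowed with the product topology. $\mathfrak{c}$ is the cardinality of the continuum. For a cardinal $\alpha$, a subset $A$ of a topological vector space $X$ is called infinitely pointwise $\alpha$-dense-lineable in $X$ if for every $x\in A$ there is a family $\{W_k: k\in\mathbb{N}\}$ of vector subspaces of $X$ such that each $W_k$ is dense in $X$, $\dim(W_k)=\alpha$, $x\in W_k\subset A\cup\{0\}$, and $W_k\cap W_n=\mathrm{span}\{x\}$ whenever $k\neq n$. *)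

(* Defs.v *)
From HB Require Import structures.
From mathcomp Require Import all_boot all_order all_algebra.
From mathcomp Require Import complex.
From mathcomp Require Import all_classical all_reals all_analysis.

Set Implicit Arguments.
Unset Strict Implicit.
Unset Printing Implicit Defensive.

Import Order.TTheory GRing.Theory Num.Theory.
Import numFieldNormedType.Exports.

Local Open Scope classical_set_scope.
Local Open Scope ring_scope.

Section LinearAlgebra.
Context {K : numFieldType} {X : lmodType K}.
Implicit Types (A B W : set X).

Definition vector_subspace W : Prop :=
  W 0 /\ forall (a : K) (u v : X), W u -> W v -> W (a *: u + v).

Definition linear_span A : set X :=
  [set x | exists (s : seq X) (c : X -> K),
    (forall v, v \in s -> A v) /\ x = \sum_(v <- s) c v *: v].

Definition linearly_independent A : Prop :=
  forall (s : seq X) (c : X -> K), uniq s -> (forall v, v \in s -> A v) ->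
    \sum_(v <- s) c v *: v = 0 -> forall v, v \in s -> c v = 0.

Definition hamel_basis B W : Prop :=
  linearly_independent B /\ linear_span B = W.

(* The cardinal is given by a representative: any set [alpha] of that size. *)
Definition has_dimension (T : Type) W (alpha : set T) : Prop :=
  exists2 B : set X, hamel_basis B W & (B #= alpha)%card.

End LinearAlgebra.

Definition infinitely_pointwise_dense_lineable (K : numFieldType)
    (X : topologicalLmodType K) (T : Type) (alpha : set T) (A : set X) : Prop :=
  forall x : X, A x ->
    exists W : nat -> set X,
      [/\ forall k, vector_subspace (W k) /\ dense (W k),
          forall k, has_dimension (W k) alpha,
          forall k, W k x /\ W k `<=` A `|` [set 0]
        & forall k n, k <> n -> W k `&` W n = linear_span [set x]].

Section HolomorphicFunctions.
Context {R : realType}.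
(* The regular algebra [R[i]^o] carries the modulus, hence the usual topology,
   and derivatives in it are complex derivatives. *)
Local Notation C := (R[i]^o).
Implicit Types Omega : set C.

(* A function on [Omega] is encoded by its extension by 0 to the whole plane,
   so that equality of codes is equality on [Omega].  As [Omega] will be open,
   derivability at a point of [Omega] does not depend on the extension. *)
Definition holomorphic_on Omega : set (C -> C) :=
  [set f | (forall z, Omega z -> derivable f z 1) /\
           (forall z, ~ Omega z -> f z = 0)].

Definition holomorphic_pred Omega : {pred C -> C} :=
  fun f => f \in holomorphic_on Omega.

Lemma holomorphic_submod_closed Omega :
  GRing.submod_closed (holomorphic_pred Omega).
Proof.
split.
  rewrite unfold_in; apply/mem_set; split=> [z _|//].
  exact: (derivable_cst (0 : C)).
move=> a f g; rewrite !unfold_in => /set_mem[df f0] /set_mem[dg g0].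
apply/mem_set; split=> z Oz.
  apply: derivableD; last exact: dg.
  exact: derivableZ (df _ Oz).
have -> : (a *: f + g) z = a *: f z + g z by [].
by rewrite f0// g0// addr0 scaler0.
Qed.

HB.instance Definition _ Omega := GRing.isSubmodClosed.Build R[i] (C -> C)
  (holomorphic_pred Omega) (holomorphic_submod_closed Omega).

Record hol Omega : Type :=
  Hol { hol_fun :> C -> C ; _ : hol_fun \in holomorphic_pred Omega }.

HB.instance Definition _ Omega := [isSub for @hol_fun Omega].
HB.instance Definition _ Omega := [Choice of hol Omega by <:].
HB.instance Definition _ Omega :=
  [SubChoice_isSubLmodule of hol Omega by <:].

Lemma hol_derivable Omega (f : hol Omega) z : Omega z -> derivable f z 1.
Proof. by case: f => f f_hol /=; have /set_mem[df _] := f_hol; exact: df. Qed.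

Lemma hol_continuous Omega (f : hol Omega) z : Omega z ->
  {for z, continuous (f : C -> C)}.
Proof.
move=> Oz; apply: differentiable_continuous.
exact/(@derivable1_diffP R[i])/hol_derivable.
Qed.

HB.instance Definition _ Omega := Topological.copy (hol Omega)
  (initial_topology (@hol_fun Omega : _ -> {family compactly_in Omega, C -> C})).

Lemma hol_cvgP Omega (F : set_system (hol Omega)) (f : hol Omega) : Filter F ->
  F --> f <-> forall K, compactly_in Omega K -> forall e : R[i], 0 < e ->
    \forall g \near F, forall z, K z -> `|f z - (g : hol Omega) z| < e.
Proof.
move=> FF; split.
  move=> Ff K cK e e0.
  have /fam_cvgP : {family compactly_in Omega, (@hol_fun Omega) @ F --> (f : C -> C)}.
    apply: cvg_trans (cvg_app _ Ff) _.
    exact: (@initial_continuous (hol Omega) {family compactly_in Omega, C -> C}).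
  move=> /(_ K cK) /(_ [set g : C -> C | forall z, K z -> `|f z - g z| < e]).
  apply.
  apply/uniform_nbhs; exists [set xy : C * C | ball xy.1 e xy.2]; split => //.
  by rewrite -entourage_ballE; exists e.
move=> H.
have Ff : {family compactly_in Omega, (@hol_fun Omega) @ F --> (f : C -> C)}.
  apply/fam_cvgP => K cK P /uniform_nbhs[E [+ EP]].
  rewrite -entourage_ballE => -[e /= e0 eE].
  apply: filterS (H K cK e e0) => g Hg; apply: EP => z Kz.
  by apply: eE; exact: Hg.
move=> P [_ [[B oB <-] Bf BP]].
apply: filterS BP _; apply: Ff.
exact: open_nbhs_nbhs.
Qed.

Lemma hol_add_continuous Omega :
  continuous (fun x : hol Omega * hol Omega => x.1 + x.2).
Proof.
move=> [f g]; apply/hol_cvgP => K cK e e0 /=.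
have e20 : 0 < e / 2 by rewrite divr_gt0.
have Hf := (hol_cvgP f (nbhs_filter f)).1 (@cvg_id (hol Omega) _) K cK _ e20.
have Hg := (hol_cvgP g (nbhs_filter g)).1 (@cvg_id (hol Omega) _) K cK _ e20.
exists ([set f' : hol Omega | forall z, K z -> `|f z - f' z| < e / 2],
        [set g' : hol Omega | forall z, K z -> `|g z - g' z| < e / 2]).
  by split; [exact: Hf|exact: Hg].
move=> [f' g'] /= [ff' gg'] z Kz.
rewrite [_ z](_ : _ = f z + g z)// [X in _ - X](_ : _ = f' z + g' z)//.
rewrite opprD addrACA (le_lt_trans (ler_normD _ _))//.
by rewrite (splitr e) ltrD// ?ff' ?gg'.
Qed.

Lemma hol_scale_continuous Omega :
  continuous (fun x : R[i]^o * hol Omega => x.1 *: x.2).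
Proof.
move=> [a f]; apply/hol_cvgP => K [KO cK] e e0 /=.
have e20 : 0 < e / 2 by rewrite divr_gt0.
pose P (bg : R[i]^o * hol Omega) z := K z -> `|a *: f z - bg.1 *: bg.2 z| < e.
suff : \forall bg \near ((a, f) : (R[i]^o * hol Omega)%type), K `<=` P bg.
  by apply: filterS => bg H z Kz; exact: H.
apply: ((compact_near_coveringP K).1 cK _ (nbhs (a, f)) P) => z Kz.
pose M := `|f z| + 1; have M0 : 0 < M by rewrite ltr_wpDl.
pose A := `|a| + 1; have A0 : 0 < A by rewrite ltr_wpDl.
have Hz : \forall z' \near z, `|f z'| < M.
  have /(@cvgrPdist_lt R[i] C)/(_ _ ltr01) := @hol_continuous Omega f z (KO z Kz).
  apply: filterS => z' h.
  rewrite -[f z'](subrK (f z)) addrC (le_lt_trans (ler_normD _ _))//.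
  by rewrite /M ltrD2l distrC.
have Hb1 : \forall b \near (a : R[i]^o), `|a - b| < e / 2 / M.
  exact: (@nbhsx_ballx R[i] C a _ (divr_gt0 e20 M0)).
have Hb2 : \forall b \near (a : R[i]^o), `|b| < A.
  have := @nbhsx_ballx R[i] C a _ ltr01.
  apply: filterS => b h.
  rewrite -[b](subrK a) addrC (le_lt_trans (ler_normD _ _))//.
  by rewrite /A ltrD2l distrC.
have Hg := (hol_cvgP f (nbhs_filter f)).1 (@cvg_id (hol Omega) _) K (conj KO cK) (e / 2 / A) (divr_gt0 e20 A0).
exists ([set z' | `|f z'| < M],
  [set bg : (R[i]^o * hol Omega)%type | [/\ `|a - bg.1| < e / 2 / M, `|bg.1| < A
   & forall w, K w -> `|f w - bg.2 w| < e / 2 / A]]).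
  split => //=.
  exists ([set b | `|a - b| < e / 2 / M /\ `|b| < A],
    [set g : hol Omega | forall w, K w -> `|f w - g w| < e / 2 / A]).
    by split => //=; exact: filterI.
  by move=> [b g] /= [[? ?] ?].
move=> [z' [b g]] /= [h1 [h2 h3 h4]] Kz'.
have -> : a *: f z' - b *: g z' = (a - b) * f z' + b * (f z' - g z').
  by rewrite mulrBl mulrBr addrA subrK.
rewrite (le_lt_trans (ler_normD _ _))// !normrM (splitr e) ltrD//.
  by rewrite -(divfK (lt0r_neq0 M0) (e / 2)) ltr_pM.
by rewrite -(divfK (lt0r_neq0 A0) (e / 2)) mulrC ltr_pM// h4.
Qed.

HB.instance Definition _ Omega :=
  PreTopologicalNmodule_isTopologicalNmodule.Build (hol Omega)
    (@hol_add_continuous Omega).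
HB.instance Definition _ Omega :=
  TopologicalNmodule_isTopologicalLmodule.Build R[i] (hol Omega)
    (@hol_scale_continuous Omega).

End HolomorphicFunctions.

(* The space of all sequences, with termwise operations and the product
   topology. *)
Definition seq_space (Y : Type) : Type := nat -> Y.

Section SequenceSpace.
Context {K : numFieldType} {X : topologicalLmodType K}.

HB.instance Definition _ := GRing.Lmodule.copy (seq_space X) (nat -> X).
HB.instance Definition _ := Topological.copy (seq_space X) {ptws nat -> X}.

Lemma seq_space_proj_continuous n : continuous (fun u : seq_space X => u n).
Proof. exact: (@proj_continuous nat (fun=> X) n). Qed.

Lemma seq_space_cvgP (F : set_system (seq_space X)) (u : seq_space X) :
  Filter F -> F --> u <-> forall n, (v n @[v --> F] --> u n).
Proof.
move=> FF; split => [Fu n|Fu].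
  by apply: cvg_trans (cvg_app _ Fu) _; exact: seq_space_proj_continuous.
apply/cvg_sup => n P [_ [[B oB <-] Bu BP]].
by apply: filterS BP _; apply: Fu; exact: open_nbhs_nbhs.
Qed.

Lemma seq_add_continuous :
  continuous (fun x : seq_space X * seq_space X => x.1 + x.2).
Proof.
move=> [u v]; apply/seq_space_cvgP => n.
apply: (@cvg_trans _ (x.1 n + x.2 n @[x --> (u, v)])) => //.
apply: (@continuous_comp _ _ _
  (fun x : seq_space X * seq_space X => (x.1 n, x.2 n))
  (fun x : X * X => x.1 + x.2)); last exact: add_continuous.
move=> P [[A B] /= [Au Bv] AB].
exists ((fun w : seq_space X => w n) @^-1` A,
        (fun w : seq_space X => w n) @^-1` B) => /=.
  by split; exact: seq_space_proj_continuous.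
by move=> x [/= Ax Bx]; exact: AB.
Qed.

Lemma seq_scale_continuous :
  continuous (fun x : K^o * seq_space X => x.1 *: x.2).
Proof.
move=> [a u]; apply/seq_space_cvgP => n.
apply: (@cvg_trans _ (x.1 *: x.2 n @[x --> ((a, u) : K^o * seq_space X)%type])) => //.
apply: (@continuous_comp _ _ _
  (fun x : K^o * seq_space X => (x.1, x.2 n) : (K^o * X)%type)
  (fun x : K^o * X => x.1 *: x.2)); last exact: scale_continuous.
move=> P [[A B] /= [Aa Bu] AB].
exists (A, (fun w : seq_space X => w n) @^-1` B) => /=.
  by split=> //; exact: seq_space_proj_continuous.
by move=> [b w] [/= Ab Bw]; exact: AB.
Qed.

HB.instance Definition _ :=
  PreTopologicalNmodule_isTopologicalNmodule.Build (seq_space X)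
    seq_add_continuous.
HB.instance Definition _ :=
  TopologicalNmodule_isTopologicalLmodule.Build K (seq_space X)
    seq_scale_continuous.

End SequenceSpace.

Section ConvergenceToZero.
Context {R : realType}.
Local Notation C := (R[i]^o).
Variable Omega : set C.
Implicit Types f : seq_space (hol Omega).

Definition converges0_pointwise : set (seq_space (hol Omega)) :=
  [set f | forall z, Omega z -> (fun n => f n z) @ \oo --> (0 : C)].

Definition converges0_compactly : set (seq_space (hol Omega)) :=
  [set f | {family compactly_in Omega,
             (fun n => f n : C -> C) @ \oo --> (cst 0 : C -> C)}].

Definition converges0_uniformly : set (seq_space (hol Omega)) :=
  [set f | {uniform Omega,
             (fun n => f n : C -> C) @ \oo --> (cst 0 : C -> C)}].

End ConvergenceToZero.

Arguments converges0_pointwise {R} Omega _.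
Arguments converges0_compactly {R} Omega _.
Arguments converges0_uniformly {R} Omega _.

(* Main.v *)
Require Import Defs.
From mathcomp Require Import all_boot all_order all_algebra.
From mathcomp Require Import complex.
From mathcomp Require Import all_classical all_reals all_analysis.
From mathcomp Require Import lra.

Import Order.TTheory GRing.Theory Num.Theory.
Import numFieldNormedType.Exports.

Local Open Scope classical_set_scope.
Local Open Scope ring_scope.

(* The three modes of convergence are uniform convergence on each member of a
   family of sets: the singletons, the compact subsets, the whole of [Omega].
   Let [x] converge to 0 for a family [G] but not for a family [H]: for some
   [K] in [H] and [e > 0], the set [M] of the [n] with [sup_K |x n| >= e] is
   infinite.  Take an almost disjoint family of infinite sets [A (k, t)]
   inside [M], [k] a natural and [t] a real number.  Multiplying [x] by the
   indicators of the [A (k, t)] preserves convergence to 0 on [G], and a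
   combination of these products and of [x] with a nonzero coefficient stays
   bounded below on [K] along infinitely many [n], even after changing
   finitely many terms.  These finitely many terms give density: the space of
   finite sequences of holomorphic functions has the cardinality of the
   continuum, so for each [k] every such sequence can be the beginning of some
   product with index [(k, t)].  Then [W k] is spanned by [x] and the modified
   products with first index [k]. *)

(** * Binary sequences inside the reals *)

(* [u] is sent to [sum_i u_i 3^-i]: with digits 0 and 1 in base 3, the first
   difference outweighs all the later digits. *)
Lemma binary_sequences_inj (R : realType) :
  exists f : (nat -> bool) -> R, injective f.
Proof.
pose r : R := 3^-1.
have r0 n : 0 < r ^+ n by rewrite exprn_gt0// invr_gt0.
pose S (u : nat -> bool) n := \sum_(i < n) (r ^+ i *+ u i).
have SS u n : S u n.+1 = S u n + r ^+ n *+ u n by rewrite /S big_ord_recr.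
have r3 n : r ^+ n = 3 * r ^+ n.+1 by rewrite exprS mulrA /r divff ?mul1r.
(* [r ^+ (m + k) / 2] is the sum of all powers of [r] beyond [m + k], so the left side bounds every
   later partial sum. *)
have tail u m k : u m = false ->
    S u (m.+1 + k)%N + r ^+ (m + k) / 2 <= S u m + r ^+ m / 2.
  move=> um; elim: k => [|k IH]; first by rewrite !addn0 SS um mulr0n addr0.
  apply: le_trans IH; rewrite !addnS addSn SS (r3 (m + k)%N).
  by have := r0 (m + k).+1; case: (u (m + k).+1); rewrite ?mulr1n ?mulr0n; lra.
have Smono u : {homo S u : m n / (m <= n)%N >-> m <= n}.
  apply: homo_leq => [//|x y z|n]; first exact: le_trans.
  by rewrite SS lerDl mulrn_wge0// ltW.
have Sub u m n : u m = false -> S u n <= S u m + r ^+ m / 2.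
  move=> um; apply: le_trans (Smono u _ _ (leq_addl m.+1 n)) _.
  apply: le_trans (tail u m n um); rewrite lerDl.
  by have := r0 (m + n)%N; lra.
have bnd u : has_ubound (range (S u)).
  exists (1 + 3 / 2) => _ [n _ <-].
  (* [Sub] needs a digit 0, so one is put in front: [S v n.+1] is a third of [S u n]. *)
  pose v i := if i is j.+1 then u j else false.
  have /(Sub v 0%N) : v 0%N = false by [].
  have -> : S v 0%N = 0 by rewrite /S big_ord0.
  move=> /(_ n.+1); rewrite /S big_ord_recl mulr0n add0r expr0.
  rewrite (eq_bigr (fun i : 'I_n => r * (r ^+ i *+ u i))); last first.
    by move=> i _; rewrite mulrnAr -exprS.
  by rewrite -mulr_sumr /r; lra.
exists (fun u => sup (range (S u))) => u v uv; apply/funext => m.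
have main (u' v' : nat -> bool) k : (forall i, (i < k)%N -> u' i = v' i) ->
    u' k = true -> v' k = false -> sup (range (S u')) <> sup (range (S v')).
  move=> agree u'k v'k e.
  have : sup (range (S v')) <= S v' k + r ^+ k / 2.
    apply: ge_sup; first by exists (S v' 0%N), 0%N.
    by move=> _ [n _ <-]; exact: Sub.
  have : S u' k.+1 <= sup (range (S u')) by apply: ub_le_sup => //; exists k.+1.
  have -> : S u' k.+1 = S v' k + r ^+ k.
    by rewrite SS u'k; congr (_ + _); apply: eq_bigr => i _; rewrite agree.
  by have := r0 k; rewrite e; lra.
elim/ltn_ind: m => m IH.
case um: (u m); case vm: (v m) => //.
  exact: False_ind _ (main u v m IH um vm uv).
exact: False_ind _ (main v u m (fun i im => esym (IH i im)) vm um (esym uv)).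
Qed.

(** * Linear spans and independence *)

Section LinearSpan.
Context {K : numFieldType} {X : lmodType K}.
Implicit Types A B : set X.

(** Puts two combinations over one common duplicate-free list, where their coefficients can be added
    or compared. *)
Lemma sum_undup_cat (s1 s2 : seq X) (c : X -> K) : uniq s1 ->
  \sum_(v <- s1) c v *: v =
  \sum_(v <- undup (s1 ++ s2)) (if v \in s1 then c v else 0) *: v.
Proof.
move=> us1.
rewrite [RHS](eq_bigr (fun v => if v \in s1 then c v *: v else 0)); last first.
  by move=> v _; case: ifP => // _; rewrite scale0r.
rewrite -big_mkcond -big_filter; apply: perm_big; apply: uniq_perm => //.
  by rewrite filter_uniq// undup_uniq.
by move=> v; rewrite mem_filter mem_undup mem_cat; case: (v \in s1).
Qed.

Lemma linear_span_uniqP A x : linear_span A x <-> exists (s : seq X) (c : X -> K),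
  [/\ uniq s, forall v, v \in s -> A v & x = \sum_(v <- s) c v *: v].
Proof.
split=> [[s [c [sA ->]]]|[s [c [_ sA ->]]]]; last by exists s, c.
exists (undup s), (fun v => c v *+ count_mem v s); split.
- exact: undup_uniq.
- by move=> v; rewrite mem_undup; exact: sA.
rewrite -big_undup_iterop_count; apply: eq_bigr => v _.
by rewrite Monoid.iteropE iter_addr_0 scalerMnl.
Qed.

Lemma linear_span_subspace A : vector_subspace (linear_span A).
Proof.
split; first by exists [::], (fun=> 0); rewrite big_nil.
move=> a u v /linear_span_uniqP[s [c [us sA ->]]].
move=> /linear_span_uniqP[t [d [ut tA ->]]].
exists (undup (s ++ t)),
  (fun w => a * (if w \in s then c w else 0) + (if w \in t then d w else 0)).
split; first by move=> w; rewrite mem_undup mem_cat => /orP[/sA|/tA].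
rewrite (sum_undup_cat s t c us) (sum_undup_cat t s d ut).
rewrite [X in _ + X](perm_big (undup (s ++ t))); last first.
  by rewrite uniq_perm ?undup_uniq// => w; rewrite !mem_undup !mem_cat orbC.
rewrite scaler_sumr -big_split; apply: eq_bigr => w _ /=.
by rewrite scalerDl scalerA.
Qed.

Lemma sub_linear_span A : A `<=` linear_span A.
Proof.
move=> x Ax; exists [:: x], (fun=> 1); rewrite big_seq1 scale1r.
by split=> // v; rewrite inE => /eqP ->.
Qed.

Lemma linear_span_mono A B : A `<=` B -> linear_span A `<=` linear_span B.
Proof. by move=> AB x [s [c [sA ->]]]; exists s, c; split=> // v /sA /AB. Qed.

Lemma linearly_independent_sub A B :
  A `<=` B -> linearly_independent B -> linearly_independent A.
Proof. by move=> AB iB s c us sA; apply: iB => // v /sA /AB. Qed.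

(** By independence of the union, two expansions of the same vector have equal coefficients, so only
    vectors common to both lists contribute. *)
Lemma linear_spanI A B : linearly_independent (A `|` B) ->
  linear_span A `&` linear_span B = linear_span (A `&` B).
Proof.
move=> iAB; apply/seteqP; split; last first.
  by move=> x ABx; split; apply: linear_span_mono ABx => y [].
move=> x [/linear_span_uniqP[s [c [us sA xs]]]].
move=> /linear_span_uniqP[t [d [ut tB xt]]].
pose c' w := if w \in s then c w else 0; pose d' w := if w \in t then d w else 0.
have cd w : w \in undup (s ++ t) -> c' w = d' w.
  move=> wst; apply/eqP; rewrite -subr_eq0; apply/eqP.
  apply: (iAB (undup (s ++ t)) (fun w => c' w - d' w)) => //.
  - exact: undup_uniq.
  - by move=> v; rewrite mem_undup mem_cat => /orP[/sA|/tB]; [left|right].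
  under eq_bigr do rewrite scalerBl.
  rewrite sumrB -(sum_undup_cat s t c us) -xs.
  rewrite (perm_big (undup (t ++ s))); last first.
    by rewrite uniq_perm ?undup_uniq// => v; rewrite !mem_undup !mem_cat orbC.
  by rewrite -(sum_undup_cat t s d ut) -xt subrr.
exists [seq w <- s | w \in t], c; split.
  by move=> w; rewrite mem_filter => /andP[/tB Bw /sA Aw].
rewrite big_filter xs (bigID (mem t)) /= [X in _ + X]big1_seq ?addr0//.
move=> w /andP[wt ws].
have : c' w = d' w by apply: cd; rewrite mem_undup mem_cat ws.
by rewrite /c' /d' ws (negbTE wt) => ->; rewrite scale0r.
Qed.

End LinearSpan.

(** * Eventual properties and almost disjoint sets of naturals *)

Lemma near_infty_all (T : eqType) (l : seq T) (P : T -> nat -> Prop) :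
  (forall i, i \in l -> \forall n \near \oo, P i n) ->
  \forall n \near \oo, forall i, i \in l -> P i n.
Proof.
elim: l => [|j l IH] lP; first exact: nearW.
have Pj : \forall n \near \oo, P j n by apply: lP; rewrite mem_head.
have /IH Pl : forall i, i \in l -> \forall n \near \oo, P i n.
  by move=> i il; apply: lP; rewrite inE il orbT.
near=> n => i; rewrite inE => /orP[/eqP ->|]; first by near: n.
by move: i; near: n.
Unshelve. all: by end_near. Qed.


(* The set of index [(k, t)] is the image of [n |-> (k, n, floor (t n))]: for
   distinct reals the floors eventually differ. *)
Lemma almost_disjoint_family (R : realType) (M : set nat) :
  (forall N, exists n, (N <= n)%N /\ M n) ->
  exists A : nat * R -> set nat,
    [/\ forall i, A i `<=` M,
        forall i N, exists n, (N <= n)%N /\ A i n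
      & forall i j, i <> j -> \forall n \near \oo, ~ (A i n /\ A j n)].
Proof.
move=> /choice[g /all_and2[gN gM]].
(* A strictly increasing sequence in [M], through which pickled codes are carried into [M]. *)
pose s := fix s n := if n is m.+1 then g (s m).+1 else g 0%N.
have sM n : M (s n) by case: n => [|n]; exact: gM.
have s_lt : {homo s : m n / (m < n)%N}.
  by apply: homo_ltn => [x y z|n]; [exact: ltn_trans|exact: gN].
have s_inj : injective s.
  move=> m n; case: (ltngtP m n) => // /s_lt h e; by rewrite e ltnn in h.
have sn n : (n <= s n)%N.
  by elim: n => // n IH; apply: leq_ltn_trans IH (s_lt _ _ (ltnSn n)).
pose code (i : nat * R) (n : nat) := (i.1, n, Num.floor (i.2 * n%:R)).
exists (fun i => range (fun n => s (pickle (code i n)))); split.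
- by move=> i _ [n _ <-].
- move=> i N; apply: contrapT => /forallNP small.
  (* Pigeonhole: the codes of [0, ..., N] are distinct because they record [n], yet [n <= s n] would
     force their pickles below [N]. *)
  pose h (n : 'I_N.+1) := pickle (code i n).
  have h_lt n : (h n < N)%N.
    rewrite ltnNge; apply/negP => Nh; apply: (small (s (h n))).
    by split; [exact: leq_trans (sn _)|exists n].
  have : (#|'I_N.+1| <= #|'I_N|)%N.
    apply: (@leq_card _ _ (fun n => Ordinal (h_lt n))) => m n [].
    by move/(pcan_inj pickleK) => [] /val_inj.
  by rewrite !card_ord ltnn.
move=> i j ij.
have [N codeN] : exists N, forall n, (N <= n)%N -> code i n <> code j n.
  case: i j ij => [k t] [l u] /= ij; rewrite /code /=.
  have [kl|/eqP kl] := eqVneq k l; last by exists 0%N => n _ [].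
  have tu : `|t - u| > 0.
    by rewrite normr_gt0 subr_eq0; apply/eqP => tu; apply: ij; rewrite kl tu.
  (* Beyond this bound [t * n] and [u * n] are more than 1 apart, so their floors differ. *)
  exists (Num.truncn (`|t - u|^-1)).+1 => n Nn [_ e].
  have n1 : 1 < `|t - u| * n%:R.
    rewrite mulrC -ltr_pdivrMr// div1r.
    by apply: lt_le_trans (truncnS_gt _) _; rewrite ler_nat.
  have := floor_itv (t * n%:R); have := floor_itv (u * n%:R); rewrite e.
  move: n1; rewrite -[X in _ * X]ger0_norm// -normrM mulrBl intrD.
  by case: ler0P; lra.
(* A common element comes from the same [n] on both sides, and then [n < N]: only finitely many are
   shared. *)
exists (\max_(n < N) s (pickle (code i n))).+1 => // m /= Nm [[n _ nm] [p _ pm]].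
have /s_inj/(pcan_inj pickleK) np : s (pickle (code i n)) = s (pickle (code j p)).
  by rewrite nm pm.
have pn : p = n by case: np.
rewrite {}pn in np.
have [/codeN//|nN] := leqP N n.
move: Nm; rewrite -nm ltnNge => /negP; apply.
exact: (leq_bigmax (Ordinal nN)).
Qed.

(** * Coding finite lists of holomorphic functions by reals *)

Lemma rational_point_near (R : realType) (z : R[i]^o) (P : R[i]^o -> Prop) :
  (\forall w \near z, P w) ->
  exists p q : rat, P (Complex (ratr p) (ratr q)).
Proof.
move=> /(@nbhs_ballP R[i] R[i]^o)[e /= e0 eP].
case: z e e0 eP => [a b] [r s]; rewrite ltcE /= => /andP[/eqP -> {s}] r0 eP.
have r2 : 0 < r / 2 by rewrite divr_gt0.
have approx (c : R) : exists q : rat, `|c - ratr q| < r / 2.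
  have /rat_in_itvoo[q] : c - r / 2 < c + r / 2 by lra.
  by rewrite in_itv/= => cq; exists q; rewrite ltr_distlC.
have [p ap] := approx a; have [q bq] := approx b.
exists p, q; apply: eP; rewrite /ball /=.
set u := a - ratr p in ap; set v := b - ratr q in bq.
have -> : Complex a b - Complex (ratr p) (ratr q) = Complex u v by [].
rewrite normc_def ltcE /= eqxx /=.
have -> : r = Num.sqrt (r ^+ 2) by rewrite sqrtr_sqr gtr0_norm.
rewrite ltr_sqrt ?exprn_gt0//.
have := ltr_pM (normr_ge0 u) (normr_ge0 u) ap ap.
have := ltr_pM (normr_ge0 v) (normr_ge0 v) bq bq.
rewrite -!expr2 !real_normK ?num_real// => hv hu.
have : 0 < r ^+ 2 by rewrite exprn_gt0.
by rewrite !expr2 in hu hv *; lra.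
Qed.

(** The difference is continuous at points of [Omega] and 0 elsewhere; a nonzero value would persist
    at a nearby rational point. *)
Lemma hol_eq_on_rational_points (R : realType) (Omega : set R[i]^o)
    (f g : hol Omega) : open Omega ->
  (forall p q : rat, f (Complex (ratr p) (ratr q)) = g (Complex (ratr p) (ratr q))) ->
  f = g.
Proof.
move=> oO fg; apply/eqP; rewrite -subr_eq0; apply/eqP.
set h := f - g.
have hE z : h z = f z - g z by [].
apply/val_inj/funext => z.
have [Oz|nOz] := pselect (Omega z); last first.
  have out (k : hol Omega) : k z = 0.
    by case: k => k hk; have /set_mem[_ /(_ z nOz)] := hk.
  exact: (out h).
change (h z = 0); apply: contrapT => /eqP hz.
have /(@cvgrPdist_lt R[i] R[i]^o)/(_ `|h z|) := @hol_continuous R Omega h z Oz.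
rewrite normr_gt0 => /(_ hz)/rational_point_near[p [q]].
by rewrite [h (Complex _ _)]hE fg subrr subr0 ltxx.
Qed.

(** Countably many bits determine a list: its length, and the rationals below the real and imaginary
    parts of its entries at rational points. *)
Lemma real_surjects_seq_hol (R : realType) (Omega : set R[i]^o) : open Omega ->
  exists d : R -> seq (hol Omega), forall s, exists t, d t = s.
Proof.
move=> oO; have [g g_inj] := binary_sequences_inj R.
pose bit (s : seq (hol Omega)) (c : option ((bool * bool) * nat * (rat * rat) * rat)) :=
  if c is Some ((b, b'), i, (p, q), r) then
    let w := (nth 0 s i : hol Omega) (Complex (ratr p) (ratr q)) in
    if b then (i < size s)%N else ratr r < (if b' then complex.Re w else complex.Im w)
  else false.
pose code s n := bit s (unpickle n).
have code_inj : injective code.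
  move=> s t st.
  have {}st c : bit s (Some c) = bit t (Some c).
    by have := congr1 (fun u => u (pickle c)) st; rewrite /code pickleK.
  have size_lt i : (i < size s)%N = (i < size t)%N.
    exact: (st ((true, true), i, (0, 0), 0)).
  have rat_lt (x y : R) : (forall r : rat, (ratr r < x) = (ratr r < y)) -> x = y.
    move=> xy; apply: contrapT => /eqP; rewrite neq_lt => /orP[] /rat_in_itvoo[r];
      rewrite in_itv/= => /andP[]; have := xy r; case: ltP; case: ltP => //; lra.
  apply: (@eq_from_nth _ 0) => [|i _].
    have := size_lt (size s); have := size_lt (size t); rewrite !ltnn.
    by case: ltngtP.
  apply: hol_eq_on_rational_points => // p q.
  apply/eqP; rewrite eq_complex; apply/andP; split; apply/eqP/rat_lt => r.
    exact: (st ((false, true), i, (p, q), r)).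
  exact: (st ((false, false), i, (p, q), r)).
(* [d] inverts [g \o code] on its range; a real that codes no list gets [[::]]. *)
have /choice[d dE] (t : R) : exists s, (exists s', g (code s') = t) -> g (code s) = t.
  have [[s sE]|no] := pselect (exists s', g (code s') = t); first by exists s.
  by exists [::] => /no.
exists d => s; exists (g (code s)).
by apply/code_inj/g_inj/dE; exists s.
Qed.

(** * Convergence to 0 on a family of sets *)

Section UniformConvergenceOnFamily.
Context {R : realType} {Omega : set R[i]^o}.
Local Notation C := (R[i]^o).
Implicit Types (G H : set (set C)) (K : set C) (x y : seq_space (hol Omega)).

Definition converges0_on G : set (seq_space (hol Omega)) :=
  [set y | forall K, G K -> forall e : R[i], 0 < e ->
     \forall n \near \oo, forall z, K z -> `|y n z| < e].

Lemma uniform_cvg0P K y :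
  {uniform K, (fun n => y n : C -> C) @ \oo --> (cst 0 : C -> C)} <->
  forall e : R[i], 0 < e -> \forall n \near \oo, forall z, K z -> `|y n z| < e.
Proof.
split=> [yK e e0|yK P /uniform_nbhs[E [+ EP]]].
  apply: (yK [set g : C -> C | forall z, K z -> `|g z| < e]).
  apply/uniform_nbhs; exists [set ab : C * C | ball ab.1 e ab.2]; split.
    by rewrite -entourage_ballE; exists e.
  by move=> g Kg z /Kg; rewrite /ball /= sub0r normrN.
rewrite -entourage_ballE => -[e /= e0 eE].
apply: filterS (yK e e0) => n yn; apply: EP => z Kz; apply: eE => /=.
by rewrite /ball /= sub0r normrN; exact: yn.
Qed.

Lemma converges0_pointwiseE :
  converges0_pointwise Omega = converges0_on [set [set z] | z in Omega].
Proof.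
apply/seteqP; split=> y.
  by move=> yO _ [z Oz <-]; apply/uniform_cvg0P; rewrite uniform_set1; exact: yO.
move=> yO z Oz.
have /uniform_cvg0P : forall e : R[i], 0 < e ->
    \forall n \near \oo, forall w, [set z] w -> `|y n w| < e.
  by apply: yO; exists z.
by rewrite uniform_set1.
Qed.

Lemma converges0_compactlyE :
  converges0_compactly Omega = converges0_on (compactly_in Omega).
Proof.
apply/seteqP; split=> y; rewrite /converges0_compactly /= => yO.
  by move=> K cK; apply/uniform_cvg0P; have /fam_cvgP := yO; exact.
by apply/fam_cvgP => K cK; apply/uniform_cvg0P; exact: yO.
Qed.

Lemma converges0_uniformlyE :
  converges0_uniformly Omega = converges0_on [set Omega].
Proof.
apply/seteqP; split=> y; rewrite /converges0_uniformly /= => yO.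
  by move=> _ ->; apply/uniform_cvg0P.
by apply/uniform_cvg0P; exact: yO.
Qed.

Lemma converges0_on_subspace G : vector_subspace (converges0_on G).
Proof.
split=> [K _ e e0|a u v uG vG K GK e e0].
  by apply: nearW => n z _; rewrite normr0.
have a0 : 0 < `|a| + 1 by rewrite ltr_wpDl.
have e20 : 0 < e / 2 by rewrite divr_gt0.
have un := uG K GK _ (divr_gt0 e20 a0); have vn := vG K GK _ e20.
apply: filterS2 un vn => n un vn z Kz.
rewrite [X in `|X|](_ : _ = a * u n z + v n z)//.
rewrite (le_lt_trans (ler_normD _ _))// (splitr e) ltr_leD//; last first.
  exact/ltW/vn.
rewrite normrM (@le_lt_trans _ _ ((`|a| + 1) * `|u n z|))//.
  by rewrite ler_wpM2r// lerDl.
by rewrite mulrC -ltr_pdivlMr// un.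
Qed.

Lemma converges0_on_eventually G x y : converges0_on G x ->
  (\forall n \near \oo, y n = 0 \/ y n = x n) -> converges0_on G y.
Proof.
move=> xG yx K GK e e0; apply: filterS2 yx (xG K GK e e0) => n yx xn z Kz.
by case: yx => ->; [rewrite normr0|exact: xn].
Qed.

Lemma not_converges0_on H x : ~ converges0_on H x -> exists K (e : R[i]),
  [/\ H K, 0 < e &
      forall N, exists n, (N <= n)%N /\ exists z, K z /\ e <= `|x n z|].
Proof.
move=> xH; apply: contrapT => no; apply: xH => K HK e e0.
apply: contrapT => no'; apply: no; exists K, e; split=> // N.
apply: contrapT => small; apply: no'; exists N => // n /= Nn z Kz.
have [//|/negP xe] := boolP (`|x n z| < e).
case: small; exists n; split=> //; exists z; split=> //.
by rewrite real_leNgt ?normr_real ?gtr0_real//; exact/negP.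
Qed.

Lemma seq_sumE (I : Type) (l : seq I) (u : I -> seq_space (hol Omega)) n :
  (\sum_(i <- l) u i) n = \sum_(i <- l) u i n.
Proof. by elim: l => [|i l IH]; rewrite ?big_nil// !big_cons -IH. Qed.

(** * Masked copies of a sequence and their independence *)

Section Lineability.
Context {J : choiceType} (x : seq_space (hol Omega)) (A : J -> set nat)
  (d : J -> seq (hol Omega)).

(** [None] stands for [x] itself, so that [x] and its masked copies form a single family. *)
Definition masked_seq (i : option J) : seq_space (hol Omega) :=
  if i is Some j then fun n =>
    if (n < size (d j))%N then nth 0 (d j) n else if n \in A j then x n else 0
  else x.

Lemma masked_seq_converges0 G i :
  converges0_on G x -> converges0_on G (masked_seq i).
Proof.
case: i => [j|//] xG; apply: converges0_on_eventually xG _.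
exists (size (d j)) => // n /= dn; rewrite ltnNge dn /=.
by case: ifP; [right|left].
Qed.

Context {H : set (set C)} {K : set C} {e : R[i]}.
Hypotheses (HK : H K) (e0 : 0 < e)
  (A_unbounded : forall j N, exists n, (N <= n)%N /\ A j n)
  (A_large : forall j n, A j n -> exists z, K z /\ e <= `|x n z|)
  (A_disjoint : forall i j, i <> j -> \forall n \near \oo, ~ (A i n /\ A j n))
  (J_infinite : infinite_set [set: J]).

(* Along [A j] the combination is eventually a constant multiple of [x], the
   constant being the coefficient of [x] plus that of index [j]. *)
Lemma masked_seq_coef l (a : option J -> R[i]) (j : J) :
  converges0_on H (\sum_(i <- l) a i *: masked_seq i) ->
  \sum_(i <- l) a i * ((i == None) || (i == Some j))%:R = 0.
Proof.
set m := (X in _ -> X = _) => lH; apply/eqP; apply: contrapT => /negP m0.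
(* On [A j] the combination will have modulus [|m| * |x n z|], which is at least this threshold at
   some [z] in [K]. *)
have /(lH K HK) small : 0 < `|m| * e by rewrite mulr_gt0// normr_gt0.
(* Holds past the replaced initial terms and past the finite overlap of the two index sets. *)
have mask i : i \in l -> \forall n \near \oo, A j n ->
    masked_seq i n = ((i == None) || (i == Some j))%:R *: x n.
  move=> _; case: i => [i|] /=; last by apply: nearW => n _; rewrite scale1r.
  have size_le h : \forall n \near \oo, (size (d h) <= n)%N by exists (size (d h)).
  rewrite (inj_eq Some_inj); have [->|/eqP ij] := eqVneq i j.
    apply: filterS (size_le j) => n; rewrite leqNgt => /negbTE -> Ajn.
    by rewrite mem_set// scale1r.
  apply: filterS2 (size_le i) (A_disjoint i j ij) => n; rewrite leqNgt => /negbTE ->.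
  by move=> nA Ajn; rewrite memNset ?scale0r// => Ain; exact: nA.
have near_mask := near_infty_all _ _ _ mask.
have [N _ Nall] := filterI small near_mask.
have [n [/Nall[sn mn] Ajn]] := A_unbounded j N.
have [z [Kz ez]] := A_large j n Ajn.
have := sn z Kz; rewrite seq_sumE.
rewrite (eq_big_seq (fun i => a i * ((i == None) || (i == Some j))%:R *: x n)); last first.
  by move=> i il; rewrite -scalerA -(mn i il Ajn).
rewrite -scaler_suml -/m [X in `|X|](_ : _ = m * x n z)// normrM.
by rewrite ltr_pM2l ?normr_gt0// => /(le_lt_trans ez); rewrite ltxx.
Qed.

(** Stronger than independence, since the combination need only converge to 0 on [H]. An index
    absent from [l] isolates the coefficient of [x]; once it is 0, each [Some j] isolates its
    own. *)
Lemma masked_seq_free l (a : option J -> R[i]) : uniq l ->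
  converges0_on H (\sum_(i <- l) a i *: masked_seq i) ->
  forall i, i \in l -> a i = 0.
Proof.
move=> ul lH.
have [j0 j0l] : exists j, Some j \notin l.
  apply: contrapT => /forallNP all_l; apply: J_infinite.
  apply: (@sub_finite_set _ _ (Some @^-1` [set` l])) => [j _|].
    by apply: contrapT => jl; apply: (all_l j); exact/negP.
  by apply: finite_preimage (finite_seq l) => i k _ _ [].
have coef j := masked_seq_coef l a j lH.
have aNone : None \in l -> a None = 0.
  move=> Nl; rewrite -[RHS](coef j0) (bigD1_seq None)//= mulr1 big1_seq ?addr0//.
  move=> i /andP[/negbTE -> il]; case: eqVneq => [ij|_]; last by rewrite mulr0.
  by rewrite -ij il in j0l.
case=> [j|//] jl.
rewrite -[RHS](coef j) (bigD1_seq (Some j))//= eqxx mulr1 big1_seq ?addr0//.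
move=> i /andP[/negbTE -> il]; rewrite orbF.
by case: eqVneq => [iN|_]; [rewrite iN aNone -?iN// mul0r|rewrite mulr0].
Qed.

Lemma masked_seq_inj : injective masked_seq.
Proof.
move=> i k ik; apply: contrapT => /eqP nik.
pose c w : R[i] := if w == k then -1 else 1.
have ci : c i = 1 by rewrite /c (negbTE nik).
have ck : c k = -1 by rewrite /c eqxx.
have comb0 : \sum_(w <- [:: i; k]) c w *: masked_seq w = 0.
  by rewrite big_cons big_seq1 ci ck ik scale1r scaleN1r subrr.
have := masked_seq_free [:: i; k] c; rewrite comb0 /= !inE nik => /(_ isT).
move=> /(_ (converges0_on_subspace H).1 i); rewrite inE eqxx ci => /(_ isT)/eqP.
by rewrite oner_eq0.
Qed.

(** Carries [masked_seq_free] from indices to vectors, by injectivity. *)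
Lemma masked_seq_span_free (s : seq (seq_space (hol Omega))) c : uniq s ->
  (forall v, v \in s -> range masked_seq v) ->
  converges0_on H (\sum_(v <- s) c v *: v) -> forall v, v \in s -> c v = 0.
Proof.
move=> us sr; have [l sl] : exists l, s = map masked_seq l.
  elim: s sr {us} => [|v s IH] sr; first by exists [::].
  have [|l ->] := IH; first by move=> u us; apply: sr; rewrite inE us orbT.
  have [|i _ <-] := sr v; first by rewrite mem_head.
  by exists (i :: l).
move: us; rewrite sl big_map (map_inj_uniq masked_seq_inj) => ul lH.
move=> _ /mapP[i il ->]; exact: masked_seq_free ul lH i il.
Qed.

Lemma masked_seq_independent : linearly_independent (range masked_seq).
Proof.
move=> s c us sr s0; apply: masked_seq_span_free => //.
by rewrite s0; exact: (converges0_on_subspace H).1.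
Qed.

Lemma masked_seq_span_sub G : converges0_on G x ->
  linear_span (range masked_seq) `<=`
    converges0_on G `\` converges0_on H `|` [set 0].
Proof.
move=> xG y [s [c [sr ys]]].
have [y0|y0] := pselect (y = 0); [by right|left; split].
  have [G0 Glin] := converges0_on_subspace G.
  rewrite ys big_seq; elim/big_ind : _ => // [u v Gu Gv|v /sr[i _ <-]].
    by rewrite -[u]scale1r; exact: Glin.
  by rewrite -[_ *: _]addr0; apply: Glin => //; exact: masked_seq_converges0.
move=> yH; apply: y0.
have : linear_span (range masked_seq) y by exists s, c.
move=> /linear_span_uniqP[t [b [ut tr yt]]].
rewrite yt in yH *; rewrite big1_seq// => v /= vt.
by rewrite (masked_seq_span_free t b)// scale0r.
Qed.

End Lineability.
End UniformConvergenceOnFamily.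

(** * Dense lineability for two families *)

Lemma converges0_on_lineable (R : realType) (Omega : set R[i]^o)
    (G H : set (set R[i]^o)) : open Omega ->
  infinitely_pointwise_dense_lineable [set: R]
    (converges0_on G `\` converges0_on H : set (seq_space (hol Omega))).
Proof.
move=> oO x [xG /not_converges0_on[K [e [HK e0 xK]]]].
have [d d_surj] := real_surjects_seq_hol R Omega oO.
have [A [A_large A_unbounded A_disjoint]] :=
  almost_disjoint_family R [set n | exists z, K z /\ e <= `|x n z|] xK.
have J_infinite : infinite_set [set: nat * R].
  move=> /(finite_preimage (f := fun n : nat => (n, 0 : R))) fin.
  by apply: infinite_nat; apply: fin => n m _ _ [].
(* With [ln], every list already occurs at some positive parameter, which frees the parameter 0. *)
pose b := masked_seq x A (fun j => d (ln j.2)).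
have b_inj : injective b.
  exact: masked_seq_inj HK e0 A_unbounded A_large A_disjoint J_infinite.
have b_free : linearly_independent (range b).
  exact: masked_seq_independent HK e0 A_unbounded A_large A_disjoint J_infinite.
(* Parameter 0 gives [x] for every [k], so each [B k] contains [x] and is still parametrized
   injectively by [R]. *)
pose idx k t : option (nat * R) := if t == 0 then None else Some (k, t).
pose B k := range (fun t => b (idx k t)).
have Bb k : B k `<=` range b by move=> _ [t _ <-]; exists (idx k t).
have xB k : B k x by exists 0; rewrite // /idx eqxx.
exists (fun k => linear_span (B k)); split.
- move=> k; split; first exact: linear_span_subspace.
  move=> U [y Uy] oU.
  pose s N := mkseq y N.
  have /choice[t tE] N : exists t, d t = s N by exact: d_surj.
  (* [w N] begins with the first [N] terms of [y], whence convergence in the product topology. *)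
  pose w N : seq_space (hol Omega) := b (idx k (expR (t N))).
  have wy : w @ \oo --> y.
    apply/seq_space_cvgP => n; apply: cvg_near_cst; exists n.+1 => // N /= nN.
    rewrite /w /idx gt_eqF ?expR_gt0// /b /= expRK tE size_mkseq nN.
    by rewrite nth_mkseq.
  have [N _ /(_ N (leqnn N)) wU] : \forall N \near \oo, U (w N).
    by apply: wy; exact: open_nbhs_nbhs.
  by exists (w N); split=> //; apply: sub_linear_span; exists (expR (t N)).
- move=> k; exists (B k).
    by split=> //; exact: linearly_independent_sub (Bb k) b_free.
  apply: inj_card_eq => t u _ _ /b_inj; rewrite /idx.
  by case: eqVneq => [->|_]; case: eqVneq => [->|_]//; case.
- move=> k; split; first exact: sub_linear_span.
  apply: subset_trans (linear_span_mono _ _ (Bb k)) _.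
  exact: (masked_seq_span_sub _ _ _ HK e0 A_unbounded A_large A_disjoint J_infinite).
move=> k l kl; rewrite linear_spanI; last first.
  by apply: linearly_independent_sub b_free => y [/Bb|/Bb].
(* For [k <> l] the two bases share only the vector of parameter 0. *)
congr (linear_span _); apply/seteqP; split=> [_ [[t _ <-] [u _]]|_ -> //].
move=> /b_inj; rewrite /idx; case: (eqVneq u 0); case: (eqVneq t 0) => //.
by move=> _ _ [lk]; case: kl.
Qed.

Theorem theorem4p3 (R : realType) (Omega : set R[i]^o)
    (Omega_open : open Omega) (Omega_neq0 : Omega !=set0) :
  infinitely_pointwise_dense_lineable [set: R]
    (converges0_pointwise Omega `\` converges0_compactly Omega) /\
  infinitely_pointwise_dense_lineable [set: R]
    (converges0_compactly Omega `\` converges0_uniformly Omega).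
Proof.
rewrite converges0_pointwiseE converges0_compactlyE converges0_uniformlyE.
by split; exact: converges0_on_lineable.
Qed.
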